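(* Let $n\ge2$, let $X_1,\dots,X_n$ be infinite dimensional Hilbert spaces and $D_k\in\mathcal{B}(X_k)$. Then for every $A\in\mathcal{B}_n$, $$\bigcup_{k=1}^n\sigma_{rw}(D_k)=\sigma_{rw}(T_n^d(A))\cup\Delta_1\cup\Delta_2,$$ where $$\Delta_1=\bigcup_{k=1}^{n-1}\Big\{\lambda:\ \beta(D_k-\lambda)=\infty,\ \beta(D_s-\lambda)<\infty\text{ for }k+1\le s\le n-1,\ \sum_{s=k+1}^{n}\alpha(D_s-\lambda)=\infty\Big\}\cap\rho_{re}(D_n)\cap\Big\{\lambda:\ \sum_{s=1}^n\alpha(D_s-\lambda)\ge\sum_{s=1}^n\beta(D_s-\lambda)\Big\}$$ (for $k=n-1$ the condition on $k+1\le s\le n-1$ is vacuous), and $$\Delta_2=\bigcup_{k=1}^{n}\Big\{\lambda:\ \beta(D_s-\lambda)<\infty\text{ for all }1\le s\le n,\ \sum_{s=1}^n\alpha(D_s-\lambda)\ge\sum_{s=1}^n\beta(D_s-\lambda),\ \beta(D_k-\lambda)>\alpha(D_k-\lambda)\Big\}.$$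
   Context: For a bounded operator $T$, $\alpha(T)=\dim\mathcal{N}(T)$, $\beta(T)=\operatorname{codim}\mathcal{R}(T)$, values in $\{0,1,\dots\}\cup\{\infty\}$, with sums/comparisons in this extended set; $\mathrm{ind}(T)=\alpha(T)-\beta(T)$. $T$ is right Fredholm if $\beta(T)<\infty$ and $\mathcal{N}(T)$ is complemented; right Weyl if right Fredholm with $\mathrm{ind}(T)\ge0$. $\sigma_{re}(T)$, $\sigma_{rw}(T)$ are the sets of $\lambda\in\mathbb{C}$ with $\lambda-T$ not right Fredholm, resp. not right Weyl; $\rho_{re}=\mathbb{C}\setminus\sigma_{re}$. $\mathcal{B}_n$ is the set of tuples $A=(A_{ij})_{1\le i<j\le n}$, $A_{ij}\in\mathcal{B}(X_j,X_i)$; $T_n^d(A)$ is the upper triangular operator matrix on $X_1\oplus\cdots\oplus X_n$ with diagonal $D_1,\dots,D_n$, entries $A_{ij}$ above the diagonal and zeros below. *)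

(* Defs.v *)
From HB Require Import structures.
From mathcomp Require Import all_boot all_order all_algebra.
From mathcomp Require Import all_classical all_reals all_analysis.
From mathcomp Require Export complex.
Set Implicit Arguments. Unset Strict Implicit. Unset Printing Implicit Defensive.
Import Order.TTheory GRing.Theory Num.Theory.
Local Open Scope ring_scope.
Local Open Scope classical_set_scope.

Section Generic.
(* Generic notions on a complex vector space V equipped with a (semi-)inner
   product [ip]; the norm is ||x||^2 = ip x x.  Convergence/Cauchy/closedness
   are phrased with the squared norm, which is equivalent. *)
Context (R : realType) (V : lmodType R[i]) (ip : V -> V -> R[i]).

Definition ip_cvg (u : nat -> V) (x : V) : Prop :=
  forall e : R[i], 0 < e -> exists N : nat, forall m : nat, (N <= m)%N ->
    ip (u m - x) (u m - x) < e.

Definition ip_cauchy (u : nat -> V) : Prop :=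
  forall e : R[i], 0 < e -> exists N : nat, forall m k : nat, (N <= m)%N -> (N <= k)%N ->
    ip (u m - u k) (u m - u k) < e.

Definition ip_closed (M : set V) : Prop :=
  forall (u : nat -> V) (x : V), (forall m, M (u m)) -> ip_cvg u x -> M x.

Definition lsubspace (M : set V) : Prop :=
  M 0 /\ forall (a : R[i]) (x y : V), M x -> M y -> M (a *: x + y).

Definition dim_ge (S : set V) (m : nat) : Prop :=
  exists v : 'I_m -> V, (forall i, S (v i)) /\
    forall c : 'I_m -> R[i], \sum_(i < m) c i *: v i = 0 -> forall i, c i = 0.

Definition codim_ge (S : set V) (m : nat) : Prop :=
  exists v : 'I_m -> V,
    forall c : 'I_m -> R[i], S (\sum_(i < m) c i *: v i) -> forall i, c i = 0.

Definition edim (S : set V) : \bar R :=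
  ereal_sup [set ((m%:R : R)%:E) | m in [set m : nat | dim_ge S m]].
Definition ecodim (S : set V) : \bar R :=
  ereal_sup [set ((m%:R : R)%:E) | m in [set m : nat | codim_ge S m]].

Definition complemented (N : set V) : Prop :=
  exists M : set V, lsubspace M /\ ip_closed M /\
    (forall x, N x -> M x -> x = 0) /\
    (forall x, exists y z, N y /\ M z /\ x = y + z).

End Generic.

Section Operators.
Context (R : realType) (V W : lmodType R[i])
  (ipV : V -> V -> R[i]) (ipW : W -> W -> R[i]).

Definition bounded_op (T : V -> W) : Prop :=
  (forall (a : R[i]) (x y : V), T (a *: x + y) = a *: T x + T y) /\
  exists M : R[i], forall x, ipW (T x) (T x) <= M * ipV x x.

Definition kernel (T : V -> W) : set V := [set x | T x = 0].
Definition range (T : V -> W) : set W := [set y | exists x, T x = y].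

Definition alpha (T : V -> W) : \bar R := edim (kernel T).
Definition beta (T : V -> W) : \bar R := ecodim (range T).
Definition ind (T : V -> W) : \bar R := (alpha T - beta T)%E.

Definition right_fredholm (T : V -> W) : Prop :=
  (beta T < +oo)%E /\ complemented ipV (kernel T).

Definition right_weyl (T : V -> W) : Prop :=
  right_fredholm T /\ (0 <= ind T)%E.
End Operators.

Section Spectra.
Context (R : realType) (V : lmodType R[i]) (ip : V -> V -> R[i]).
Definition lsubop (l : R[i]) (T : V -> V) : V -> V := fun x => l *: x - T x.
Definition opsubl (T : V -> V) (l : R[i]) : V -> V := fun x => T x - l *: x.

Definition sigma_re (T : V -> V) : set R[i] :=
  [set l | ~ right_fredholm ip (lsubop l T)].
Definition rho_re (T : V -> V) : set R[i] := ~` sigma_re T.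
Definition sigma_rw (T : V -> V) : set R[i] :=
  [set l | ~ right_weyl ip (lsubop l T)].
End Spectra.

Record hilbertSpace (R : realType) := HilbertSpace {
  hcar :> lmodType R[i];
  hinner : hcar -> hcar -> R[i];
  hinnerDl : forall (a : R[i]) (x y z : hcar),
      hinner (a *: x + y) z = a * hinner x z + hinner y z;
  hinnerC : forall x y : hcar, hinner y x = conjc (hinner x y);
  hinner_ge0 : forall x : hcar, 0 <= hinner x x;
  hinner_eq0 : forall x : hcar, hinner x x = 0 -> x = 0;
  hcomplete : forall u : nat -> hcar, ip_cauchy hinner u ->
      exists x, ip_cvg hinner u x
}.

Definition infinite_dimensional (R : realType) (X : hilbertSpace R) : Prop :=
  forall m : nat, dim_ge [set: hcar X] m.

Section DirectSum.
Context (R : realType) (n : nat) (X : 'I_n -> hilbertSpace R).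

Definition dsum : Type := forall i : 'I_n, hcar (X i).
HB.instance Definition _ := Choice.copy dsum (forall i : 'I_n, hcar (X i)).

Definition ds_zero : dsum := fun i => 0.
Definition ds_opp (x : dsum) : dsum := fun i => - x i.
Definition ds_add (x y : dsum) : dsum := fun i => x i + y i.
Definition ds_scale (a : R[i]) (x : dsum) : dsum := fun i => a *: x i.

Lemma ds_addA : associative ds_add.
Proof. by move=> x y z; apply: functional_extensionality_dep => i; rewrite /ds_add addrA. Qed.
Lemma ds_addC : commutative ds_add.
Proof. by move=> x y; apply: functional_extensionality_dep => i; rewrite /ds_add addrC. Qed.
Lemma ds_add0 : left_id ds_zero ds_add.
Proof. by move=> x; apply: functional_extensionality_dep => i; rewrite /ds_add add0r. Qed.
Lemma ds_addN : left_inverse ds_zero ds_opp ds_add.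
Proof. by move=> x; apply: functional_extensionality_dep => i; rewrite /ds_add /ds_opp addNr. Qed.

HB.instance Definition _ := GRing.isZmodule.Build dsum ds_addA ds_addC ds_add0 ds_addN.

Lemma ds_scaleA a b v : ds_scale a (ds_scale b v) = ds_scale (a * b) v.
Proof. by apply: functional_extensionality_dep => i; rewrite /ds_scale scalerA. Qed.
Lemma ds_scale1 : left_id 1 ds_scale.
Proof. by move=> v; apply: functional_extensionality_dep => i; rewrite /ds_scale scale1r. Qed.
Lemma ds_scaleDr : right_distributive ds_scale (@GRing.add dsum).
Proof. by move=> a u v; apply: functional_extensionality_dep => i; rewrite /ds_scale scalerDr. Qed.
Lemma ds_scaleDl v : {morph ds_scale^~ v : a b / a + b}.
Proof. by move=> a b; apply: functional_extensionality_dep => i; rewrite /ds_scale scalerDl. Qed.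

HB.instance Definition _ :=
  GRing.Zmodule_isLmodule.Build R[i] dsum ds_scaleA ds_scale1 ds_scaleDr ds_scaleDl.

Definition ds_inner (x y : dsum) : R[i] := \sum_(i < n) hinner (x i) (y i).

Definition Tnd (D : forall k : 'I_n, X k -> X k)
  (A : forall i j : 'I_n, X j -> X i) : dsum -> dsum :=
  fun x i => D i (x i) + \sum_(j < n | (i < j)%N) A i j (x j).
End DirectSum.

(* Main.v *)
Require Import Defs.
From HB Require Import structures.
From mathcomp Require Import all_boot all_order all_algebra.
From mathcomp Require Import all_classical all_reals all_analysis.
From mathcomp Require Import complex ring lra.
Import Order.TTheory GRing.Theory Num.Theory.
Local Open Scope ring_scope.
Local Open Scope classical_set_scope.
Set Implicit Arguments. Unset Strict Implicit. Unset Printing Implicit Defensive.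

(* T - l is the product F_(n-1) ... F_0, where F_k replaces the k-th coordinate
   of x by (D_k - l) x_k + sum_(j > k) A_kj x_j and fixes the others; F_k has the
   same alpha and beta as D_k - l.  For a product fg the exact sequence
     0 -> ker g -> ker fg -> ker f -> coker g -> coker fg -> coker f -> 0
   gives additivity of the index when all betas are finite.  If k is the largest
   index with beta (D_k - l) infinite while beta (T - l) is finite, it forces the
   kernel of F_(n-1) ... F_(k+1), hence some later alpha, to be infinite.
   In Hilbert spaces kernels are complemented by orthogonal projection, so that
   being right Fredholm only means beta < oo. *)

(** * Dimensions of quotients, kernels and cokernels *)

Section Quotients.
Context {R : realType} {V : lmodType R[i]}.
Implicit Types (S M N : set V).

Lemma lsubspace_sum S m (c : 'I_m -> R[i]) (v : 'I_m -> V) :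
  lsubspace S -> (forall i, S (v i)) -> S (\sum_(i < m) c i *: v i).
Proof.
move=> [S0 Sl] Sv; elim/big_rec: _ => // i x _ Sx; exact: Sl.
Qed.

Lemma lsubspaceD S x y : lsubspace S -> S x -> S y -> S (x + y).
Proof. by move=> [_ h] Sx Sy; have := h 1 x y Sx Sy; rewrite scale1r. Qed.

Lemma lsubspaceZ S a x : lsubspace S -> S x -> S (a *: x).
Proof. by move=> [S0 h] Sx; have := h a x 0 Sx S0; rewrite addr0. Qed.

Lemma lsubspaceB S x y : lsubspace S -> S x -> S y -> S (x - y).
Proof.
move=> hS Sx Sy; apply: lsubspaceD => //; rewrite -scaleN1r; exact: lsubspaceZ.
Qed.

Lemma lsubspace1 : lsubspace [set (0 : V)].
Proof. by split=> // a x y /= -> ->; rewrite scaler0 addr0. Qed.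

Lemma lsubspaceT : lsubspace [set: V].
Proof. by []. Qed.

Lemma lsubspaceI S N : lsubspace S -> lsubspace N -> lsubspace (S `&` N).
Proof.
move=> [S0 hS] [N0 hN]; split=> // a x y [Sx Nx] [Sy Ny].
by split; [exact: hS|exact: hN].
Qed.

Definition sumset S N : set V := [set z | exists x y, [/\ S x, N y & z = x + y]].

Lemma lsubspace_sumset S N : lsubspace S -> lsubspace N -> lsubspace (sumset S N).
Proof.
move=> [S0 hS] [N0 hN]; split; first by exists 0, 0; rewrite addr0.
move=> a _ _ [x [y [Sx Ny ->]]] [x' [y' [Sx' Ny' ->]]].
exists (a *: x + x'), (a *: y + y'); split; [exact: hS|exact: hN|].
by rewrite scalerDr addrACA.
Qed.

(** Independence is taken modulo [N], so [qdim S N] is the dimension of the image of [S] in $V/N$.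
    Kernel dimensions ($N=0$) and codimensions ($S=V$) become instances of one notion. *)
Definition qdim_ge S N (m : nat) : Prop :=
  exists v : 'I_m -> V, (forall i, S (v i)) /\
    forall c : 'I_m -> R[i], N (\sum_(i < m) c i *: v i) -> forall i, c i = 0.

Definition qdim S N : \bar R :=
  ereal_sup [set ((m%:R : R)%:E) | m in [set m : nat | qdim_ge S N m]].

Lemma qdim_ge0 S N : qdim_ge S N 0.
Proof. by exists (fun=> 0); split=> [|c _] []. Qed.

Lemma qdim_geS S N m : qdim_ge S N m.+1 -> qdim_ge S N m.
Proof.
move=> [v [Sv iv]]; exists (v \o widen_ord (leqnSn m)); split=> [i|c Nc i] //=.
(* The dropped last vector receives the coefficient 0. *)
pose d (i : 'I_m.+1) := if unlift ord_max i is Some j then c j else 0.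
have dw (j : 'I_m) : d (widen_ord (leqnSn m) j) = c j.
  rewrite /d; have -> : widen_ord (leqnSn m) j = lift ord_max j.
    by apply: val_inj => /=; rewrite /bump leqNgt ltn_ord.
  by rewrite liftK.
have := iv d; rewrite big_ord_recr /= {2}/d unlift_none scale0r addr0.
under eq_bigr do rewrite dw.
by move=> /(_ Nc (widen_ord (leqnSn m) i)); rewrite dw.
Qed.

Lemma qdim_ge_le S N m k : (k <= m)%N -> qdim_ge S N m -> qdim_ge S N k.
Proof.
by move=> /subnK <-; elim: (m - k)%N => //= d IH; rewrite addSn => /qdim_geS.
Qed.

Lemma qdim_nneg S N : (0 <= qdim S N)%E.
Proof. by apply: ereal_sup_ubound; exists 0%N => //; exact: qdim_ge0. Qed.

(** The supremum is infinite or attained; in the second case [m] is the largest size of an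
    independent family, which is what basis arguments need. *)
Variant qdim_spec S N : \bar R -> Prop :=
| QdimInf of (forall m, qdim_ge S N m) : qdim_spec S N +oo%E
| QdimFin m of qdim_ge S N m & ~ qdim_ge S N m.+1 : qdim_spec S N (m%:R)%:E.

Lemma qdimP S N : qdim_spec S N (qdim S N).
Proof.
have [h|/existsNP h] := pselect (forall m, qdim_ge S N m).
  suff -> : qdim S N = +oo%E by constructor.
  apply/eqyP => A A0; apply: (@le_trans _ _ ((Num.bound A)%:R : R)%:E).
    by rewrite lee_fin; apply/ltW/archi_boundP/ltW.
  by apply: ereal_sup_ubound => /=; exists (Num.bound A).
have /ex_minnP[m] : exists m, `[< ~ qdim_ge S N m >].
  by case: h => m hm; exists m; apply/asboolP.
move=> /asboolP hm min.
case: m hm min => [/(_ (qdim_ge0 S N))//|m hm min].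
have hm' : qdim_ge S N m.
  by apply: contrapT => /asboolP/min; rewrite ltnn.
suff -> : qdim S N = (m%:R)%:E by exact: QdimFin.
apply/eqP; rewrite eq_le; apply/andP; split; last first.
  by apply: ereal_sup_ubound => /=; exists m.
apply: ge_ereal_sup => _ [k /= hk <-]; rewrite lee_fin ler_nat.
by rewrite leqNgt; apply/negP => mk; apply: hm; exact: qdim_ge_le mk hk.
Qed.

Definition spans S N p (e : 'I_p -> V) : Prop :=
  (forall i, S (e i)) /\ forall x, S x ->
    exists c : 'I_p -> R[i], N (x - \sum_(i < p) c i *: e i).
Arguments spans S N {p} e.

(** A maximal independent family spans: a vector outside its span modulo [N] could be adjoined to
    it. *)
Lemma qdim_ge_max_spans S N m :
  lsubspace N -> qdim_ge S N m -> ~ qdim_ge S N m.+1 ->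
  exists e : 'I_m -> V, spans S N e.
Proof.
move=> hN [e [Se ie]] hm; exists e; split=> // x Sx; apply: contrapT => hx.
apply: hm; exists (fun i => if unlift ord_max i is Some j then e j else x).
split=> [i|c]; first by case: unliftP => [j|] _.
have dw (j : 'I_m) : unlift ord_max (widen_ord (leqnSn m) j) = Some j.
  have -> : widen_ord (leqnSn m) j = lift ord_max j.
    by apply: val_inj => /=; rewrite /bump leqNgt ltn_ord.
  by rewrite liftK.
rewrite big_ord_recr /= unlift_none.
under eq_bigr do rewrite dw.
move=> Nc; have c0 : c ord_max = 0.
  (* A nonzero coefficient of [x] could be divided out, putting [x] in the span modulo [N]. *)
  apply: contrapT => /eqP c0; apply: hx.
  exists (fun i => - ((c ord_max)^-1 * c (widen_ord (leqnSn m) i))).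
  have := lsubspaceZ (c ord_max)^-1 hN Nc.
  rewrite scalerDr scalerA mulVf// scale1r addrC scaler_sumr -sumrN.
  by under eq_bigr do rewrite scalerA; under [in X in _ -> X]eq_bigr do
    rewrite scaleNr opprK.
move: Nc; rewrite c0 scale0r addr0 => /ie h i.
have [j ->|->//] := unliftP ord_max i.
have -> : lift ord_max j = widen_ord (leqnSn m) j.
  by apply: val_inj => /=; rewrite /bump leqNgt ltn_ord.
exact: h.
Qed.

(** Steinitz bound: if $m>p$, the $m\times p$ matrix of coordinates has a nonzero left kernel, and a
    row of it is a forbidden relation modulo [N]. *)
Lemma spans_qdim_ge S N p (e : 'I_p -> V) m :
  lsubspace N -> spans S N e -> qdim_ge S N m -> (m <= p)%N.
Proof.
move=> hN [Se spe] [v [Sv iv]]; rewrite leqNgt; apply/negP => pm.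
have /choice[B hB] := fun i => spe _ (Sv i).
pose M : 'M[R[i]]_(m, p) := \matrix_(i, j) B i j.
have : (0 < \rank (kermx M))%N.
  by rewrite mxrank_ker subn_gt0; apply: leq_ltn_trans pm; exact: rank_leq_col.
rewrite lt0n mxrank_eq0 => /eqP K0; apply: K0.
apply/row_matrixP => k; rewrite row0; apply/rowP => i; rewrite [RHS]mxE.
set c := row k (kermx M); apply: (iv (c ord0)) => {i}.
have cM : c *m M = 0 by rewrite /c -row_mul mulmx_ker row0.
(* Since [c *m M = 0], subtracting the expansions in [e] changes nothing, and each remaining
   difference lies in [N]. *)
have -> : \sum_i c ord0 i *: v i =
    \sum_i c ord0 i *: (v i - \sum_j B i j *: e j).
  under [RHS]eq_bigr do rewrite scalerBr scaler_sumr.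
  rewrite sumrB exchange_big /= [X in _ - X]big1 ?subr0// => j _.
  under eq_bigr do rewrite scalerA.
  rewrite -scaler_suml (_ : \sum_i _ = (c *m M) ord0 j).
    by rewrite cM mxE scale0r.
  by rewrite mxE; apply: eq_bigr => i _; rewrite [M _ _]mxE.
exact: lsubspace_sum.
Qed.

Lemma spans_cat {S M N p q} {e : 'I_p -> V} {e' : 'I_q -> V} :
  lsubspace S -> lsubspace N -> M `<=` S -> 
  spans S M e -> spans M N e' ->
  exists e'' : 'I_(p + q) -> V, spans S N e''.
Proof.
move=> hS hN MS [Se he] [Me' he'].
exists (fun i => match fintype.split i with inl j => e j | inr j => e' j end).
split=> [i|x Sx]; first by case: fintype.split => // j; exact: MS.
have [c /he'[d hd]] := he _ Sx.
exists (fun i => match fintype.split i with inl j => c j | inr j => d j end).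
rewrite big_split_ord /=.
under eq_bigr do rewrite (unsplitK (inl _)).
under [X in _ - (_ + X)]eq_bigr do rewrite (unsplitK (inr _)).
by rewrite opprD addrA.
Qed.

Lemma qdim_ge_cat S M N p q : lsubspace M -> M `<=` S -> N `<=` M ->
  qdim_ge S M p -> qdim_ge M N q -> qdim_ge S N (p + q).
Proof.
move=> hM MS NM [v [Sv iv]] [w [Mw iw]].
exists (fun i => match fintype.split i with inl j => v j | inr j => w j end).
split=> [i|c]; first by case: fintype.split => // j; exact: MS.
rewrite big_split_ord /=.
under eq_bigr do rewrite (unsplitK (inl _)).
under [X in _ + X]eq_bigr do rewrite (unsplitK (inr _)).
move=> Nc.
have c1 : forall j, c (lshift q j) = 0.
  apply: (iv (c \o lshift q)).
  have := lsubspaceB _ (NM _ Nc) (lsubspace_sum (c \o @rshift p q) hM Mw).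
  by rewrite addrK; apply.
have c2 : forall j, c (rshift p j) = 0.
  apply: (iw (c \o @rshift p q)); move: Nc; rewrite big1 ?add0r// => j _.
  by rewrite c1 scale0r.
by move=> i; rewrite -(splitK i); case: fintype.split => j /=.
Qed.

(** Concatenating independent families bounds the left side from below; concatenating spanning
    families bounds it from above when both summands are finite. *)
Lemma qdimD S M N : lsubspace S -> lsubspace M -> lsubspace N ->
  N `<=` M -> M `<=` S -> qdim S N = (qdim S M + qdim M N)%E.
Proof.
move=> hS hM hN NM MS.
have ge p q := @qdim_ge_cat S M N p q hM MS NM.
case: (qdimP S M) => [i1|p hp hp']; case: (qdimP M N) => [i2|q hq hq'];
  case: (qdimP S N) => [//|r hr hr'].
- by case: hr'; have := ge r.+1 0%N (i1 _) (qdim_ge0 _ _); rewrite addn0.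
- by case: hr'; have := ge r.+1 0%N (i1 _) (qdim_ge0 _ _); rewrite addn0.
- by case: hr'; have := ge 0%N r.+1 (qdim_ge0 _ _) (i2 _).
- have [e he] := qdim_ge_max_spans hM hp hp'.
  have [e' he'] := qdim_ge_max_spans hN hq hq'.
  have [f hf] := spans_cat hS hN MS he he'.
  by move=> h; have := spans_qdim_ge hN hf (h (p + q).+1); rewrite ltnn.
- have [e he] := qdim_ge_max_spans hM hp hp'.
  have [e' he'] := qdim_ge_max_spans hN hq hq'.
  have [f hf] := spans_cat hS hN MS he he'.
  rewrite -EFinD -natrD; congr (_%:R%:E); apply/eqP; rewrite eqn_leq.
  rewrite (spans_qdim_ge hN hf hr) leqNgt; apply/negP => rpq.
  by apply: hr'; apply: qdim_ge_le rpq (ge _ _ hp hq).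
Qed.

End Quotients.

(** * Linear maps, isomorphic quotients and the kernel-cokernel sequence *)

Section LinearMaps.
Context {R : realType}.

Lemma linear0P {V W : lmodType R[i]} {h : V -> W} : linear h -> h 0 = 0.
Proof.
by move=> hl; have := hl (-1) 0 0; rewrite addr0 scaler0 scaleN1r addNr.
Qed.

Lemma linear_sumP {V W : lmodType R[i]} {h : V -> W} m
    (c : 'I_m -> R[i]) (v : 'I_m -> V) :
  linear h -> h (\sum_(i < m) c i *: v i) = \sum_(i < m) c i *: h (v i).
Proof.
move=> hl; elim/big_rec2: _ => [|i y1 y2 _ <-]; first exact: linear0P.
exact: hl.
Qed.

Lemma linear_comp {U V W : lmodType R[i]} {g : U -> V} {f : V -> W} :
  linear g -> linear f -> linear (f \o g).
Proof. by move=> hg hf a x y /=; rewrite hg hf. Qed.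

Lemma lsubspace_kernel {V W : lmodType R[i]} {h : V -> W} :
  linear h -> lsubspace (Defs.kernel h).
Proof.
move=> hl; split; first exact: linear0P.
by move=> a x y; rewrite /Defs.kernel /= hl => -> ->; rewrite scaler0 addr0.
Qed.

Lemma lsubspace_range {V W : lmodType R[i]} {h : V -> W} :
  linear h -> lsubspace (Defs.range h).
Proof.
move=> hl; split; first by exists 0; exact: linear0P.
by move=> a _ _ [x <-] [y <-]; exists (a *: x + y); exact: hl.
Qed.

(** The three conditions on [h] say that it induces a well-defined, surjective and injective map
    from $S$ modulo $N$ to $P$ modulo $Q$. Independent families are pushed forward by [h] and lifted
    back up to errors in [Q]. *)
Lemma qdim_iso {V W : lmodType R[i]} {h : V -> W} {S N : set V} {P Q : set W} :
  linear h -> lsubspace S -> lsubspace Q ->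
  (forall x, S x -> P (h x)) ->
  (forall y, P y -> exists2 x, S x & Q (y - h x)) ->
  (forall x, S x -> N x <-> Q (h x)) ->
  qdim S N = qdim P Q.
Proof.
move=> hl hS hQ SP PS NQ; congr (ereal_sup (image _ _)).
apply/seteqP; split=> m /= [v [Sv iv]].
  exists (h \o v); split=> [i|c /=]; first exact: SP.
  rewrite -linear_sumP// -NQ; first exact: iv.
  exact: lsubspace_sum.
have /choice[w hw] : forall i, exists x, S x /\ Q (v i - h x).
  by move=> i; have [x Sx Qx] := PS _ (Sv i); exists x.
exists w; split=> [i|c Nc]; first by case: (hw i).
apply: iv; have Sc : S (\sum_i c i *: w i).
  by apply: lsubspace_sum => // i; case: (hw i).
have := (NQ _ Sc).1 Nc; rewrite linear_sumP// => Qc.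
rewrite (_ : \sum_i _ = \sum_i c i *: (v i - h (w i)) + \sum_i c i *: h (w i)).
  apply: lsubspaceD => //; apply: lsubspace_sum => // i; by case: (hw i).
by under [X in _ = X + _]eq_bigr do rewrite scalerBr; rewrite sumrB subrK.
Qed.

Lemma alphaE {V W : lmodType R[i]} (h : V -> W) :
  alpha h = qdim (Defs.kernel h) [set 0].
Proof. by []. Qed.

Lemma betaE {V W : lmodType R[i]} (h : V -> W) :
  beta h = qdim [set: W] (Defs.range h).
Proof.
congr (ereal_sup (image _ _)); apply/seteqP; split=> m /= [v].
  by move=> iv; exists v.
by move=> [_ iv]; exists v.
Qed.

(* The six-term exact sequence, cut at the images of its maps. *)
Lemma alpha_beta_comp {U V W : lmodType R[i]} {g : U -> V} {f : V -> W} :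
  linear g -> linear f ->
  exists p q r s t : \bar R,
    ([/\ 0 <= p, 0 <= q, 0 <= r, 0 <= s & 0 <= t] /\
    [/\ alpha (f \o g) = p + q, alpha f = q + r & alpha g = p] /\
    [/\ beta g = s + r, beta (f \o g) = s + t & beta f = t])%E.
Proof.
move=> hg hf; have hfg := linear_comp hg hf.
have kg := lsubspace_kernel hg; have kf := lsubspace_kernel hf.
have kfg := lsubspace_kernel hfg.
have rg := lsubspace_range hg; have rf := lsubspace_range hf.
have rfg := lsubspace_range hfg.
pose I := Defs.kernel f `&` Defs.range g; have hI : lsubspace I := lsubspaceI kf rg.
pose J := sumset (Defs.kernel f) (Defs.range g).
have hJ : lsubspace J := lsubspace_sumset kf rg.
(* The third value is the rank of the connecting map from $\ker f$ to $\mathrm{coker}\,g$, hence its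
   appearance in both [alpha f] and [beta g]. *)
exists (qdim (Defs.kernel g) [set 0]), (qdim I [set 0]), (qdim (Defs.kernel f) I),
  (qdim [set: V] J), (qdim [set: W] (Defs.range f)).
split; first by split; exact: qdim_nneg.
rewrite !alphaE !betaE; split; split => //.
- rewrite (@qdimD _ _ _ (Defs.kernel g))//; last 3 first.
  + exact: lsubspace1.
  + by move=> _ ->; exact: linear0P.
  + by move=> x /= gx; rewrite /Defs.kernel /= gx; exact: linear0P.
  (* [g] maps $\ker(fg)$ onto [I] with kernel $\ker g$. *)
  rewrite addeC; congr (_ + _)%E; apply: (qdim_iso hg) => //.
  + exact: lsubspace1.
  + by move=> x fgx; split=> //; exists x.
  + by move=> y [fy [x gx]]; exists x; rewrite ?/Defs.kernel /= gx// subrr.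
- rewrite (@qdimD _ _ _ I) 1?[RHS]addeC//; first exact: lsubspace1.
  + by move=> _ ->; split; [exact: linear0P|exact: rg.1].
  + by move=> x [].
(* Second isomorphism theorem: $\ker f/I\cong J/\mathrm{ran}\,g$, induced by the identity. *)
- rewrite (@qdimD _ _ _ J)//; last first.
    by move=> y gy; exists 0, y; rewrite add0r; split=> //; exact: kf.1.
  congr (_ + _)%E; apply/esym.
  apply: (@qdim_iso _ _ id) => //.
  + by move=> x fx; exists x, 0; rewrite addr0; split=> //; exact: rg.1.
  + by move=> _ [x [y [fx gy ->]]]; exists x => //; rewrite addrC addKr.
  + by move=> x fx; split=> [[]|].
(* [f] induces an isomorphism from $V/J$ onto $\mathrm{ran}\,f/\mathrm{ran}(fg)$. *)
- rewrite (@qdimD _ _ _ (Defs.range f))//; last by move=> _ [x <-]; exists (g x).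
  rewrite addeC; congr (_ + _)%E; apply/esym.
  apply: (qdim_iso hf) => //.
  + by move=> x _; exists x.
  + by move=> _ [x <-]; exists x => //; rewrite subrr; exact: rfg.1.
  + move=> x _; split=> [[y [z [fy [u <-] ->]]]|[u fgu]].
      exists u => /=; have := hf 1 y (g u); rewrite !scale1r => ->.
      by rewrite fy add0r.
    exists (x - g u), (g u); split; [|by exists u|by rewrite subrK].
    rewrite /Defs.kernel /= addrC; have := hf (-1) (g u) x.
    by rewrite !scaleN1r => ->; rewrite -fgu addNr.
Qed.

End LinearMaps.

(** * Defects and index of a finite composition *)

Section Compositions.
Context {R : realType} {V : lmodType R[i]}.
Local Open Scope ereal_scope.

Lemma qdim_self (S : set V) : lsubspace S -> qdim S S = 0.
Proof.
move=> hS; have h1 : ~ qdim_ge S S 1.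
  move=> [v [Sv /(_ (fun=> 1%R) (lsubspace_sum _ hS Sv) ord0)]].
  by move=> /eqP; rewrite oner_eq0.
by case: (qdimP S S) => [/(_ 1%N)|[//|m] /(qdim_ge_le (ltn0Sn m))].
Qed.

Lemma alpha_id : alpha (@id V) = 0.
Proof. by rewrite alphaE; exact/qdim_self/lsubspace1. Qed.

Lemma beta_id : beta (@id V) = 0.
Proof.
rewrite betaE (_ : Defs.range id = setT); first exact: qdim_self lsubspaceT.
by apply/seteqP; split=> // x _; exists x.
Qed.

Lemma alpha_ge0 {W : lmodType R[i]} (f : V -> W) : 0 <= alpha f.
Proof. by rewrite alphaE; exact: qdim_nneg. Qed.

Lemma beta_ge0 {W : lmodType R[i]} (f : V -> W) : 0 <= beta f.
Proof. by rewrite betaE; exact: qdim_nneg. Qed.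

(** The sign of the index is expressed by a comparison, so no difference of extended numbers is
    formed. *)
Definition weyl (f : V -> V) : Prop := beta f < +oo /\ beta f <= alpha f.

Variable F : nat -> V -> V.
Hypothesis linF : forall k, linear (F k).

(** The head of the list acts first: [iota 0 n] yields $F_{n-1}\circ\dots\circ F_0$. *)
Definition compseq (s : seq nat) : V -> V := foldl (fun g k => F k \o g) id s.

Lemma compseq_rcons s k : compseq (rcons s k) = F k \o compseq s.
Proof. by rewrite /compseq foldl_rcons. Qed.

Lemma compseq_cat s1 s2 : compseq (s1 ++ s2) = compseq s2 \o compseq s1.
Proof.
elim/last_ind: s2 => [|s2 k IH]; first by rewrite cats0.
by rewrite -rcons_cat !compseq_rcons IH.
Qed.

Lemma linear_compseq s : linear (compseq s).
Proof.
elim/last_ind: s => [//|s k IH]; rewrite compseq_rcons.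
exact: linear_comp.
Qed.

Lemma alpha_compseq_le s : alpha (compseq s) <= \sum_(k <- s) alpha (F k).
Proof.
elim/last_ind: s => [|s k IH]; first by rewrite big_nil alpha_id.
rewrite compseq_rcons -cats1 big_cat big_seq1.
have [p [q [r [u [t [[p0 q0 r0 u0 t0] [[-> ag af] _]]]]]]] :=
  alpha_beta_comp (linear_compseq s) (linF k).
by rewrite ag -af; apply: leeD => //; exact: leeDl.
Qed.

Lemma beta_compseq_le s : beta (compseq s) <= \sum_(k <- s) beta (F k).
Proof.
elim/last_ind: s => [|s k IH]; first by rewrite big_nil beta_id.
rewrite compseq_rcons -cats1 big_cat big_seq1.
have [p [q [r [u [t [[p0 q0 r0 u0 t0] [_ [bg -> bf]]]]]]]] :=
  alpha_beta_comp (linear_compseq s) (linF k).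
rewrite bf; apply: leeD => //; apply: le_trans IH; rewrite bg; exact: leeDl.
Qed.

Lemma beta_le_comp {g f : V -> V} :
  linear g -> linear f -> beta f <= beta (f \o g).
Proof.
move=> hg hf.
have [p [q [r [u [t [[p0 q0 r0 u0 t0] [_ [_ -> ->]]]]]]]] := alpha_beta_comp hg hf.
exact: leeDr.
Qed.

(** The kernel of the map from $\mathrm{coker}\,g$ to $\mathrm{coker}(fg)$ is a quotient of $\ker
    f$. *)
Lemma beta_le_alphaD {g f : V -> V} :
  linear g -> linear f -> beta g <= alpha f + beta (f \o g).
Proof.
move=> hg hf.
have [p [q [r [u [t [[p0 q0 r0 u0 t0] [[_ -> _] [-> -> _]]]]]]]] :=
  alpha_beta_comp hg hf.
by rewrite addeC leeD//; [exact: leeDr|exact: leeDl].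
Qed.

(** Additivity of the index, with the negative terms moved across because the alphas may be
    infinite. *)
Lemma index_compseq s : (forall k, k \in s -> beta (F k) < +oo) ->
  alpha (compseq s) + \sum_(k <- s) beta (F k) =
  \sum_(k <- s) alpha (F k) + beta (compseq s).
Proof.
elim/last_ind: s => [|s k IH] bs; first by rewrite !big_nil alpha_id beta_id.
have {}IH : alpha (compseq s) + \sum_(k <- s) beta (F k) =
    \sum_(k <- s) alpha (F k) + beta (compseq s).
  by apply: IH => j js; apply: bs; rewrite mem_rcons inE js orbT.
have bk : beta (F k) < +oo by apply: bs; rewrite mem_rcons mem_head.
have bgS := beta_compseq_le s.
have Sb : \sum_(k <- s) beta (F k) < +oo.
  rewrite big_seq; apply: lte_sum_pinfty => j js.
  by apply: bs; rewrite mem_rcons inE js orbT.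
have Sb0 : 0 <= \sum_(k <- s) beta (F k) by apply: sume_ge0 => j _; exact: beta_ge0.
have Sa0 : 0 <= \sum_(k <- s) alpha (F k) by apply: sume_ge0 => j _; exact: alpha_ge0.
rewrite compseq_rcons -cats1 !big_cat !big_seq1.
have [p [q [r [u [t [[p0 q0 r0 u0 t0] [[-> af ag] [bg -> bf]]]]]]]] :=
  alpha_beta_comp (linear_compseq s) (linF k).
move: IH bk bgS; rewrite /= af ag bg bf; clear af ag bg bf.
move: Sb Sb0 Sa0.
move: (\sum_(k <- s) beta _) (\sum_(k <- s) alpha _) => B A.
(* Finiteness of the betas makes [B], [r], [u] and [t] real; by [IH], [p] and [A] are then infinite
   together, and an infinite term makes both sides infinite. Only the all-real case is left. *)
move: B A p q r u t p0 q0 r0 u0 t0 => [B| |] [A| |] [p| |] [q| |] [r| |] [u| |] [t| |] //.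
by move=> _ _ _ _ _ _ _ _ [IH] _ _; rewrite -!EFinD; congr _%:E; lra.
Qed.

Lemma beta_last_le n : beta (F n) <= beta (compseq (iota 0 n.+1)).
Proof.
by rewrite -addn1 iotaD cats1 compseq_rcons; exact: beta_le_comp (linear_compseq _) _.
Qed.

(** Write the product as $G F_k H$. The cokernel of $F_k$ is controlled by $\ker G$ and
    $\mathrm{coker}(GF_k)$, and the latter is a quotient of the cokernel of the whole product. *)
Lemma beta_le_alpha_tail n k : (k < n)%N ->
  beta (F k) <= \sum_(k.+1 <= j < n) alpha (F j) + beta (compseq (iota 0 n)).
Proof.
move=> kn; have -> : iota 0 n = iota 0 k ++ [:: k] ++ iota k.+1 (n - k.+1).
  by rewrite -[in LHS](subnKC kn) -addn1 -!addnA iotaD /= addn1 add0n.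
rewrite !compseq_cat.
set G := compseq (iota k.+1 _); set H := compseq (iota 0 k).
have hG : linear G := linear_compseq _; have hH : linear H := linear_compseq _.
have -> : compseq [:: k] = F k by [].
apply: (le_trans (beta_le_alphaD (linF k) hG)); apply: leeD.
  exact: alpha_compseq_le.
by apply: (beta_le_comp hH); exact: linear_comp.
Qed.

End Compositions.

(** * The Weyl property of a product versus that of its factors *)

Section Core.
Context {R : realType} {V : lmodType R[i]}.
Local Open Scope ereal_scope.
Variable F : nat -> V -> V.
Hypothesis linF : forall k, linear (F k).

(** Used with [a], [b] the sums of the alphas and betas of the factors: finiteness of [b] and
    [beta f] permits cancellation, and [alpha f] and [a] are infinite together. *)
Lemma weyl_index_le (f : V -> V) (a b : \bar R) : 0 <= a -> 0 <= b -> b < +oo ->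
  beta f < +oo -> alpha f + b = a + beta f -> (beta f <= alpha f) = (b <= a).
Proof.
move: (alpha_ge0 f) (beta_ge0 f).
move: (alpha f) (beta f) => x y.
move: x y a b => [x| |] [y| |] [a| |] [b| |] //; rewrite ?leey//.
by move=> _ _ _ _ _ _ [h]; rewrite !lee_fin; apply/idP/idP => ?; lra.
Qed.

(** This is the pointwise form of the spectral identity, for arbitrary linear factors; the second
    and third alternatives correspond to $\Delta_1$ and $\Delta_2$. *)
Lemma weyl_compseq n : (0 < n)%N ->
  (exists2 k, (k < n)%N & ~ weyl (F k)) <->
  [\/ ~ weyl (compseq F (iota 0 n)),
     exists k, [/\ [/\ (k < n.-1)%N, beta (F k) = +oo,
        forall s, (k < s)%N -> (s < n.-1)%N -> beta (F s) < +oo &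
        \sum_(k.+1 <= s < n) alpha (F s) = +oo], beta (F n.-1) < +oo &
        \sum_(0 <= s < n) beta (F s) <= \sum_(0 <= s < n) alpha (F s)] |
     exists k, [/\ (k < n)%N, forall s, (s < n)%N -> beta (F s) < +oo,
        \sum_(0 <= s < n) beta (F s) <= \sum_(0 <= s < n) alpha (F s) &
        alpha (F k) < beta (F k)] ].
Proof.
move=> n0.
have Sa0 : 0 <= \sum_(0 <= s < n) alpha (F s).
  by apply: sume_ge0 => j _; exact: alpha_ge0.
have Sb0 : 0 <= \sum_(0 <= s < n) beta (F s).
  by apply: sume_ge0 => j _; exact: beta_ge0.
set T := compseq F _.
(* When every beta is finite, additivity of the index decides whether the product is Weyl. *)
have fin_case : (forall s, (s < n)%N -> beta (F s) < +oo) ->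
    beta T < +oo /\ ((beta T <= alpha T) =
      (\sum_(0 <= s < n) beta (F s) <= \sum_(0 <= s < n) alpha (F s))).
  move=> bs; have Sb : \sum_(0 <= s < n) beta (F s) < +oo.
    by rewrite big_nat; apply: lte_sum_pinfty => s /andP[_ /bs].
  have bT : beta T < +oo.
    by apply: le_lt_trans Sb; have := beta_compseq_le linF (iota 0 n); rewrite /index_iota subn0.
  split=> //; apply: weyl_index_le => //.
  have := @index_compseq _ _ _ linF (iota 0 n); rewrite /index_iota subn0; apply.
  by move=> k; rewrite mem_iota => /andP[_ /bs].
split; last first.
  move=> h; apply: contrapT => /forall2NP hW.
  have {}hW k : (k < n)%N -> weyl (F k).
    by move=> kn; case: (hW k) => // /contrapT.
  have bs s : (s < n)%N -> beta (F s) < +oo by move=> /hW[].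
  case: h => [|[k [[kn bk _ _] _ _]]|[k [kn _ _]]].
  - apply; have [bT bTa] := fin_case bs; split=> //; rewrite bTa !big_nat.
    by apply: lee_sum => s /andP[_ /hW[]].
  - by have := bs k (leq_trans kn (leq_pred n)); rewrite bk ltxx.
  - by have [_] := hW _ kn; rewrite leNgt => /negP.
move=> [k kn nW]; have [[bT aT]|] := pselect (weyl T); last by constructor 1.
(* The range of the product lies in the range of the factor applied last. *)
have bl : beta (F n.-1) < +oo.
  by apply: le_lt_trans bT; rewrite /T -(prednK n0); exact: beta_last_le.
have [bs|/existsNP[j /not_implyP[jn /negP bj]]] :=
    pselect (forall s, (s < n)%N -> beta (F s) < +oo).
  constructor 3; exists k; split => //; first by rewrite -(fin_case bs).2.
  by rewrite ltNge; apply/negP => h; apply: nW; split=> //; exact: bs.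
constructor 2.
have ex : exists i, (i < n)%N && (beta (F i) == +oo).
  by exists j; rewrite jn; move: bj; rewrite ltey negbK.
have ub i : (i < n)%N && (beta (F i) == +oo) -> (i <= n)%N.
  by move=> /andP[/ltnW].
(* The index required by the second alternative is the largest one with infinite beta; it differs
   from [n.-1] by [bl]. *)
case: (ex_maxnP ex ub) => m /andP[mn /eqP bm] hm.
have mn1 : (m < n.-1)%N.
  rewrite -ltnS (prednK n0) ltn_neqAle mn andbT; apply/eqP => mE.
  by move: bl; rewrite -mE bm ltxx.
have tl : \sum_(m.+1 <= s < n) alpha (F s) = +oo.
  apply/eqP; rewrite -leye_eq leNgt; apply/negP => h.
  have := beta_le_alpha_tail linF mn; rewrite bm leNgt => /negP; apply.
  exact: lte_add_pinfty.
exists m; split=> //; first split=> //.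
  move=> s ms sn; rewrite ltey; apply/negP => bs.
  by have := hm s; rewrite bs (leq_trans sn (leq_pred n)) leqNgt ms => /(_ isT).
(* The infinite tail makes the whole sum of alphas infinite, so the comparison of sums is
   automatic. *)
rewrite [leRHS](big_cat_nat _ (n := m.+1))//= tl addey ?leey// -ltNye.
by apply: (lt_le_trans (ltNyr 0%R)); apply: sume_ge0 => i _; exact: alpha_ge0.
Qed.
End Core.

(** * Orthogonal projection *)

Section Hilbert.
Import ComplexField.
Context {R : realType}.
Implicit Types (H K : hilbertSpace R).
Local Open Scope complex_scope.

Lemma Re_scale (a : R) (z : R[i]) : complex.Re (a%:C * z) = a * complex.Re z.
Proof. by case: z => x y /=; rewrite mul0r subr0. Qed.

(** Taking the real part loses nothing, since $\langle x,x\rangle\ge0$ is real; estimates then take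
    place in the ordered field [R]. *)
Definition nsq H (x : H) : R := complex.Re (hinner x x).
Definition absq (z : R[i]) : R := complex.Re z ^+ 2 + complex.Im z ^+ 2.

Lemma absqE z : z * conjc z = (absq z)%:C.
Proof. by case: z => x y; apply/eqP; rewrite eq_complex /absq /=; apply/andP; split; apply/eqP; ring. Qed.

Lemma absq_eq0 z : absq z <= 0 -> z = 0.
Proof.
case: z => x y; rewrite /absq /= => h; apply/eqP; rewrite eq_complex /=.
have /eqP : x ^+ 2 + y ^+ 2 = 0 by apply/eqP; rewrite eq_le h addr_ge0 ?sqr_ge0.
by rewrite paddr_eq0 ?sqr_ge0// !sqrf_eq0.
Qed.

Lemma absqD z w : absq (z + w) <= 2 * absq z + 2 * absq w.
Proof. by case: z => a b; case: w => c d; rewrite /absq /=; have := sqr_ge0 (a - c); have := sqr_ge0 (b - d); nra. Qed.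

Lemma hinnerxx H (x : H) : hinner x x = (nsq x)%:C.
Proof.
by have := hinner_ge0 x; rewrite /nsq lecE; case: (hinner x x) => a b /= /andP[/eqP ->].
Qed.

Lemma nsq_ge0 H (x : H) : 0 <= nsq x.
Proof. by have := hinner_ge0 x; rewrite hinnerxx ler0c. Qed.

Lemma nsq_eq0 H (x : H) : nsq x <= 0 -> x = 0.
Proof.
move=> h; apply: hinner_eq0; rewrite hinnerxx.
by have -> : nsq x = 0 by apply/eqP; rewrite eq_le h nsq_ge0.
Qed.

Lemma hinnerD H (x y z : H) : hinner (x + y) z = hinner x z + hinner y z.
Proof. by have := hinnerDl 1 x y z; rewrite scale1r mul1r. Qed.

Lemma hinner0 H (z : H) : hinner 0 z = 0.
Proof. by apply: (addrI (hinner (0 : H) z)); rewrite -hinnerD !addr0. Qed.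

Lemma hinnerZ H a (x z : H) : hinner (a *: x) z = a * hinner x z.
Proof. by have := hinnerDl a x 0 z; rewrite hinner0 !addr0. Qed.

Lemma hinnerB H (x y z : H) : hinner (x - y) z = hinner x z - hinner y z.
Proof. by rewrite hinnerD -scaleN1r hinnerZ mulN1r. Qed.

Lemma hinnerDr H (x y z : H) : hinner z (x + y) = hinner z x + hinner z y.
Proof. by rewrite hinnerC hinnerD rmorphD /= -!hinnerC. Qed.

Lemma hinnerZr H a (x z : H) : hinner z (a *: x) = conjc a * hinner z x.
Proof. by rewrite hinnerC hinnerZ rmorphM /= -!hinnerC. Qed.

Lemma hinnerBr H (x y z : H) : hinner z (x - y) = hinner z x - hinner z y.
Proof. by rewrite hinnerC hinnerB rmorphB /= -!hinnerC. Qed.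

Lemma hinner0r H (z : H) : hinner z 0 = 0.
Proof. by rewrite hinnerC hinner0 conjc0. Qed.

Lemma nsqZ H a (x : H) : nsq (a *: x) = absq a * nsq x.
Proof.
by apply: complexI; rewrite -hinnerxx hinnerZ hinnerZr mulrA absqE hinnerxx rmorphM.
Qed.

Lemma nsqN H (x : H) : nsq (- x) = nsq x.
Proof. by rewrite -scaleN1r nsqZ /absq /=; ring. Qed.

Lemma parallelogram H (x y : H) :
  nsq (x + y) + nsq (x - y) = 2 * nsq x + 2 * nsq y.
Proof.
apply: complexI; rewrite !mulr_natl !(rmorphD, rmorphMn) /= -!hinnerxx.
rewrite !(hinnerB, hinnerBr, hinnerD, hinnerDr); ring.
Qed.

(** Substitute for the triangle inequality with squared norms; its factors 2 explain the tolerances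
    [e / 4] below. *)
Lemma nsqD H (x y : H) : nsq (x + y) <= 2 * nsq x + 2 * nsq y.
Proof. by rewrite -parallelogram lerDl nsq_ge0. Qed.

(* Expand the hypothesis at the minimiser [c = <x, z> / <z, z>]. *)
Lemma absq_inner_le H (x z : H) (d : R) :
  (forall c, d <= nsq (x - c *: z)) -> absq (hinner x z) <= nsq z * (nsq x - d).
Proof.
move=> h; have [/nsq_eq0 ->|z0] := leP (nsq z) 0.
  by rewrite hinner0r /nsq hinner0 /absq /=; lra.
set w := hinner x z; pose c := w * ((nsq z)^-1)%:C.
have nz : (nsq z)%:C != 0 by rewrite (inj_eq (@complexI R) _ 0) gt_eqF.
have cE : conjc c = conjc w * ((nsq z)^-1)%:C by rewrite /c rmorphM /= oppr0.
suff e : nsq z * nsq (x - c *: z) = nsq z * nsq x - absq w.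
  by have := h c; rewrite -(ler_pM2l z0) e; lra.
apply: complexI; rewrite rmorphB !rmorphM /= -!absqE -!hinnerxx.
rewrite !(hinnerB, hinnerBr, hinnerZ, hinnerZr) (hinnerC x z) -/w cE hinnerxx /c.
rewrite fmorphV /=; field.
exact: nz.
Qed.

Lemma cauchy_schwarz H (x z : H) : absq (hinner x z) <= nsq z * nsq x.
Proof.
by rewrite -[X in _ * X]subr0; apply: absq_inner_le => c; exact: nsq_ge0.
Qed.

Lemma ip_cvgP H (u : nat -> H) x : ip_cvg (@hinner R H) u x <->
  forall e : R, 0 < e -> exists N, forall m, (N <= m)%N -> nsq (u m - x) < e.
Proof.
split=> h e e0.
  have /h[N hN] : 0 < e%:C by rewrite ltcR.
  by exists N => m /hN; rewrite hinnerxx ltcR.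
(* In the order on [R[i]], a positive element is real. *)
have eE : e = (complex.Re e)%:C.
  by case: e e0 => a b; rewrite ltcE /= => /andP[/eqP ->].
move: e0; rewrite eE ltcR => /h[N hN].
by exists N => m /hN; rewrite hinnerxx ltcR.
Qed.

Lemma ip_cauchyP H (u : nat -> H) : ip_cauchy (@hinner R H) u <->
  forall e : R, 0 < e -> exists N, forall m k, (N <= m)%N -> (N <= k)%N ->
    nsq (u m - u k) < e.
Proof.
split=> h e e0.
  have /h[N hN] : 0 < e%:C by rewrite ltcR.
  by exists N => m k Nm /(hN _ _ Nm); rewrite hinnerxx ltcR.
have eE : e = (complex.Re e)%:C.
  by case: e e0 => a b; rewrite ltcE /= => /andP[/eqP ->].
move: e0; rewrite eE ltcR => /h[N hN].
by exists N => m k Nm /(hN _ _ Nm); rewrite hinnerxx ltcR.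
Qed.

Lemma ip_cvg_cst H (x : H) : ip_cvg (@hinner R H) (fun=> x) x.
Proof.
by apply/ip_cvgP => e e0; exists 0%N => m _; rewrite subrr /nsq hinner0.
Qed.

Lemma ip_cvg_unique H (u : nat -> H) x y :
  ip_cvg (@hinner R H) u x -> ip_cvg (@hinner R H) u y -> x = y.
Proof.
move=> /ip_cvgP hx /ip_cvgP hy; apply/eqP; rewrite -subr_eq0; apply/eqP/nsq_eq0.
apply/ler_addgt0Pr => e e0; rewrite add0r.
have e4 : 0 < e / 4 by lra.
have [N hN] := hx _ e4; have [M hM] := hy _ e4.
have h1 := hN _ (leq_maxl N M); have h2 := hM _ (leq_maxr N M).
have -> : x - y = (u (maxn N M) - y) - (u (maxn N M) - x).
  by rewrite opprB [RHS]addrC subrKA.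
by apply: le_trans (nsqD _ _) _; rewrite nsqN; lra.
Qed.

Lemma ip_cvgD H (u v : nat -> H) x y : ip_cvg (@hinner R H) u x ->
  ip_cvg (@hinner R H) v y -> ip_cvg (@hinner R H) (fun m => u m + v m) (x + y).
Proof.
move=> /ip_cvgP hx /ip_cvgP hy; apply/ip_cvgP => e e0.
have e4 : 0 < e / 4 by lra.
have [N hN] := hx _ e4; have [M hM] := hy _ e4.
exists (maxn N M) => m; rewrite geq_max => /andP[/hN h1 /hM h2].
by rewrite opprD addrACA; apply: le_lt_trans (nsqD _ _) _; lra.
Qed.

Lemma bounded_op_cvg H K (T : H -> K) u x :
  bounded_op (@hinner R H) (@hinner R K) T -> ip_cvg (@hinner R H) u x ->
  ip_cvg (@hinner R K) (T \o u) (T x).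
Proof.
move=> [lT [M hM]] /ip_cvgP hu; apply/ip_cvgP => e e0.
(* The given bound is a complex number of unknown sign; this replacement is real, positive and at
   least its real part. *)
pose M' := `|complex.Re M| + 1; have M0 : 0 < M' by rewrite ltr_wpDl.
have [N hN] := hu (e / M') (divr_gt0 e0 M0).
exists N => m /hN; rewrite ltr_pdivlMr// mulrC /=; apply: le_lt_trans.
have -> : T (u m) - T x = T (u m - x).
  by have := lT (-1) x (u m); rewrite !scaleN1r addrC => ->; rewrite addrC.
have := hM (u m - x); rewrite !hinnerxx lecE mulrC Re_scale /= => /andP[_].
move=> /le_trans; apply; rewrite mulrC ler_wpM2r ?nsq_ge0//.
by rewrite (le_trans (ler_norm _))// lerDl.
Qed.

Lemma ip_cvgZ H (u : nat -> H) x a : ip_cvg (@hinner R H) u x ->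
  ip_cvg (@hinner R H) (fun m => a *: u m) (a *: x).
Proof.
apply: (@bounded_op_cvg H H (fun y => a *: y)); split.
  by move=> b y z; rewrite scalerDr !scalerA mulrC.
exists (absq a)%:C => y.
by rewrite !hinnerxx nsqZ rmorphM.
Qed.

Lemma ip_cvg_sum H I (s : seq I) (P : pred I) (u : I -> nat -> H) (x : I -> H) :
  (forall i, P i -> ip_cvg (@hinner R H) (u i) (x i)) ->
  ip_cvg (@hinner R H) (fun m => \sum_(i <- s | P i) u i m) (\sum_(i <- s | P i) x i).
Proof.
move=> h; elim: s => [|i s IH].
  under eq_fun do rewrite big_nil; rewrite big_nil; exact: ip_cvg_cst.
under eq_fun do rewrite big_cons; rewrite big_cons.
by case: ifP => // Pi; exact: ip_cvgD (h _ Pi) IH.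
Qed.

Lemma exists_invn_lt (e : R) : 0 < e ->
  exists N, forall m, (N <= m)%N -> (m.+1%:R : R)^-1 < e.
Proof.
move=> e0; exists (Num.bound e^-1) => m hm.
rewrite invf_plt ?posrE//; apply: lt_le_trans (archi_boundP _) _.
  by rewrite invr_ge0 ltW.
by rewrite ler_nat ltnW.
Qed.

(** The projection is the limit of a minimising sequence for the distance to [N], which is Cauchy by
    the parallelogram law. Orthogonality is obtained by passing to the limit in approximate
    orthogonality along the sequence. *)
Lemma exists_orthogonal_proj H (N : set H) :
  lsubspace N -> ip_closed (@hinner R H) N ->
  forall x, exists2 y, N y & forall z, N z -> hinner (x - y) z = 0.
Proof.
move=> hN clN x; pose A := [set nsq (x - y) | y in N].
have hA : has_inf A.
  split; first by exists (nsq (x - 0)), 0 => //; exact: hN.1.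
  by exists 0 => _ [y _ <-]; exact: nsq_ge0.
pose d := inf A.
have dle y : N y -> d <= nsq (x - y).
  by move=> Ny; apply: ge_inf; [exact: hA.2|exists y].
have /choice[y hy] : forall m : nat, exists y, N y /\ nsq (x - y) < d + m.+1%:R^-1.
  move=> m; have m0 : 0 < (m.+1%:R : R)^-1 by rewrite invr_gt0 ltr0Sn.
  by have [_ [y Ny <-] ?] := inf_adherent m0 hA; exists y.
have [l hl] : exists l, ip_cvg (@hinner R H) y l.
  apply: hcomplete; apply/ip_cauchyP => e e0.
  have e4 : 0 < e / 4 by lra.
  have [M hM] := exists_invn_lt e4.
  exists M => m k /hM hm /hM hk; have [Nm ym] := hy m; have [Nk yk] := hy k.
  have hp := parallelogram (x - y k) (x - y m).
  have -> : y m - y k = (x - y k) - (x - y m) by rewrite opprB [RHS]addrC subrKA.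
  (* The sum is twice the difference between [x] and the midpoint of [y k] and [y m], which lies in
     [N]. *)
  have hd4 : 4 * d <= nsq ((x - y k) + (x - y m)).
    have /dle : N (2^-1 *: (y k + y m)) by apply: lsubspaceZ => //; exact: lsubspaceD.
    have -> : (x - y k) + (x - y m) = 2%:R *: (x - 2^-1 *: (y k + y m)).
      rewrite scalerBr scalerA mulfV ?pnatr_eq0// scale1r scaler_nat mulr2n.
      by rewrite opprD addrACA.
    by rewrite nsqZ /absq /= => hd; lra.
  by move: (m.+1%:R^-1 : R) (k.+1%:R^-1 : R) hm hk ym yk => em ek *; lra.
exists l; first by apply: clN hl => m; case: (hy m).
move=> z Nz; apply: absq_eq0; apply/ler_addgt0Pr => e e0; rewrite add0r.
(* The 4 absorbs the two terms doubled by [absqD]; the added 1 keeps [c] positive for $z=0$. *)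
pose c := 4 * (nsq z + 1); have c0 : 0 < c by have := nsq_ge0 z; rewrite /c; lra.
have ec : 0 < e / c by apply: divr_gt0.
have [M1 h1] := exists_invn_lt ec; have /ip_cvgP/(_ _ ec)[M2 h2] := hl.
pose m := maxn M1 M2; have {}h1 := h1 m (leq_maxl _ _).
have {}h2 := h2 m (leq_maxr _ _); have [Nm ym] := hy m.
have -> : x - l = (x - y m) + (y m - l) by rewrite addrA subrK.
rewrite hinnerD; apply: le_trans (absqD _ _) _.
(* Translating [y m] along [z] stays in [N], so [d] bounds all these distances from below and
   near-minimality gives near-orthogonality. *)
have i1 : absq (hinner (x - y m) z) <= nsq z * (nsq (x - y m) - d).
  apply: absq_inner_le => b; rewrite -addrA -opprD; apply: dle.
  by apply: lsubspaceD => //; exact: lsubspaceZ.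
have i2 := cauchy_schwarz (y m - l) z.
have z0 := nsq_ge0 z.
have i3 : nsq z * (nsq (x - y m) - d) <= nsq z * (e / c).
  by apply: ler_wpM2l => //; rewrite lerBlDl ltW// (lt_trans ym)// ltrD2l.
have i4 : nsq z * nsq (y m - l) <= nsq z * (e / c).
  by apply: ler_wpM2l => //; exact: ltW.
have i5 : 4 * (nsq z * (e / c)) <= e.
  rewrite !mulrA ler_pdivrMr// mulrC ler_wpM2l ?ltW//.
  by rewrite /c; lra.
lra.
Qed.

(** The complement is the orthogonal one, with the decomposition supplied by the projection. *)
Lemma complemented_closed H (N : set H) : lsubspace N ->
  ip_closed (@hinner R H) N -> complemented (@hinner R H) N.
Proof.
move=> hN clN; exists [set x | forall z, N z -> hinner x z = 0].
split; [|split; [|split]].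
- split; first by move=> z _; exact: hinner0.
  by move=> a x y hx hy z Nz; rewrite hinnerDl hx// hy// mulr0 addr0.
(* Closedness: $\langle u_M-x,z\rangle=-\langle x,z\rangle$ tends to 0 by Cauchy-Schwarz. *)
- move=> u x hu /ip_cvgP hx z Nz; apply: absq_eq0.
  apply/ler_addgt0Pr => e e0; rewrite add0r.
  have c0 : 0 < nsq z + 1 by have := nsq_ge0 z; lra.
  have [M hM] := hx _ (divr_gt0 e0 c0).
  have := hM M (leqnn M); rewrite ltr_pdivlMr// => h.
  have := cauchy_schwarz (u M - x) z; rewrite hinnerB hu// sub0r.
  have -> : absq (- hinner x z) = absq (hinner x z).
    by case: (hinner x z) => a b; rewrite /absq /=; ring.
  by have := nsq_ge0 (u M - x); nra.
- by move=> x Nx /(_ _ Nx); exact: hinner_eq0.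
- move=> x; have [y Ny hy] := exists_orthogonal_proj hN clN x.
  by exists y, (x - y); split=> //; split=> //; rewrite addrC subrK.
Qed.

Definition seq_continuous H K (T : H -> K) := forall u x,
  ip_cvg (@hinner R H) u x -> ip_cvg (@hinner R K) (T \o u) (T x).

Lemma kernel_closed H K (T : H -> K) :
  seq_continuous T -> ip_closed (@hinner R H) (Defs.kernel T).
Proof.
move=> cT u x hu /cT hx; rewrite /Defs.kernel /=; apply: (ip_cvg_unique hx).
rewrite (_ : T \o u = fun=> 0); first exact: ip_cvg_cst.
by apply/funext => m; exact: hu.
Qed.

End Hilbert.

(** * Operators on the direct sum *)

Section DirectSumHilbert.
Import ComplexField.
Context {R : realType} {n : nat} (X : 'I_n -> hilbertSpace R).
Local Open Scope complex_scope.

Lemma ds_innerDl (a : R[i]) (x y z : dsum X) :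
  ds_inner (a *: x + y) z = a * ds_inner x z + ds_inner y z.
Proof.
rewrite /ds_inner mulr_sumr -big_split /=; apply: eq_bigr => i _; exact: hinnerDl.
Qed.

Lemma ds_innerC (x y : dsum X) : ds_inner y x = conjc (ds_inner x y).
Proof. by rewrite /ds_inner rmorph_sum /=; apply: eq_bigr => i _; exact: hinnerC. Qed.

Lemma ds_inner_ge0 (x : dsum X) : 0 <= ds_inner x x.
Proof. by apply: sumr_ge0 => i _; exact: hinner_ge0. Qed.

Lemma ds_inner_eq0 (x : dsum X) : ds_inner x x = 0 -> x = 0.
Proof.
move=> /eqP; rewrite psumr_eq0 => [/allP h|i _]; last exact: hinner_ge0.
apply: functional_extensionality_dep => i; apply: hinner_eq0; apply/eqP.
by apply: h; rewrite mem_index_enum.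
Qed.

Lemma hinner_le_ds_inner (x : dsum X) i : hinner (x i) (x i) <= ds_inner x x.
Proof.
rewrite /ds_inner (bigD1 i)//= lerDl; apply: sumr_ge0 => j _; exact: hinner_ge0.
Qed.

Lemma ds_cvgP (u : nat -> dsum X) (x : dsum X) : ip_cvg (@ds_inner R n X) u x <->
  forall i, ip_cvg (@hinner R (X i)) (fun m => u m i) (x i).
Proof.
split=> [h i e /h[N hN]|h e e0].
  by exists N => m /hN; apply: le_lt_trans; exact: (hinner_le_ds_inner (u m - x) i).
(* Dividing by [n.+1] keeps the sum of [n] terms strictly below [e] and covers an empty index
   set. *)
have e1 : 0 < e / n.+1%:R by rewrite divr_gt0// ltr0Sn.
have /choice[N hN] := fun i => h i _ e1.
exists (\max_(i < n) N i)%N => m hm.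
apply: (@le_lt_trans _ _ (\sum_(i < n) (e / n.+1%:R))).
  apply: ler_sum => i _; apply/ltW/hN.
  exact: leq_trans (leq_bigmax i) hm.
rewrite sumr_const card_ord -[ltLHS]mulr_natr -mulrA gtr_pMr// mulrC ltr_pdivrMr ?ltr0Sn//.
by rewrite mul1r ltr_nat.
Qed.

Lemma ds_complete (u : nat -> dsum X) : ip_cauchy (@ds_inner R n X) u ->
  exists x, ip_cvg (@ds_inner R n X) u x.
Proof.
move=> h; have /(_ _)/cid c : forall i, exists x, ip_cvg (@hinner R (X i)) (fun m => u m i) x.
  move=> i; apply: hcomplete => e /h[N hN]; exists N => m k Nm Nk.
  by apply: le_lt_trans (hN _ _ Nm Nk); exact: (hinner_le_ds_inner (u m - u k) i).
by exists (fun i => sval (c i)); apply/ds_cvgP => i; exact: (svalP (c i)).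
Qed.

(** Packaging the direct sum as a Hilbert space makes the projection results available for the
    operator matrix. *)
Definition ds_hilbert : hilbertSpace R :=
  HilbertSpace ds_innerDl ds_innerC ds_inner_ge0 ds_inner_eq0 ds_complete.

Context (D : forall k : 'I_n, X k -> X k) (A : forall i j : 'I_n, X j -> X i).

Lemma Tnd_seq_continuous :
  (forall k, bounded_op (@hinner R (X k)) (@hinner R (X k)) (@D k)) ->
  (forall i j : 'I_n, (i < j)%N ->
     bounded_op (@hinner R (X j)) (@hinner R (X i)) (@A i j)) ->
  @seq_continuous R ds_hilbert ds_hilbert (Tnd D A).
Proof.
move=> hD hA u x /ds_cvgP hu; apply/ds_cvgP => i.
apply: ip_cvgD; first exact: (bounded_op_cvg (hD i) (hu i)).
apply: ip_cvg_sum => j ij; exact: (bounded_op_cvg (hA _ _ ij) (hu j)).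
Qed.

End DirectSumHilbert.

(** * Factorisation of the operator matrix into row operations *)

Section Factorisation.
Context {R : realType} {n : nat} {X : 'I_n -> hilbertSpace R}.
Context {D : forall k : 'I_n, X k -> X k} {A : forall i j : 'I_n, X j -> X i}.
Hypothesis linD : forall k, linear (@D k).
Hypothesis linA : forall i j : 'I_n, (i < j)%N -> linear (@A i j).

(** The index is a natural number to fit [compseq]; for $k\ge n$ the map is the identity. *)
Definition row_step (k : nat) (x : dsum X) : dsum X :=
  fun i => if i == k :> nat then Tnd D A x i else x i.

Lemma linear_Tnd : linear (Tnd D A).
Proof.
move=> a x y; apply: functional_extensionality_dep => i.
rewrite /Tnd /= linD.
under eq_bigr => j ij do rewrite (linA ij).
rewrite big_split /= -scaler_sumr addrACA -scalerDr //.
Qed.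

Lemma linear_row_step k : linear (row_step k).
Proof.
move=> a x y; apply: functional_extensionality_dep => i; rewrite /row_step.
by case: ifP => ik; [rewrite linear_Tnd|]; rewrite /= /GRing.add /= /ds_add /GRing.scale /= /ds_scale ik.
Qed.

(** Row [m] reads only the coordinates $j\ge m$, which the preceding factors have left untouched. *)
Lemma compseq_row_step m x i : compseq row_step (iota 0 m) x i =
  if (i < m)%N then Tnd D A x i else x i.
Proof.
elim: m i => [//|m IH] i; rewrite -addn1 iotaD cats1 compseq_rcons /= add0n {1}/row_step.
rewrite addn1 ltnS leq_eqVlt; case: eqVneq => [im|im] /=; last exact: IH.
rewrite /Tnd IH im ltnn; congr (_ + _); apply: eq_bigr => j ij.
by rewrite IH ltnNge (ltnW ij).
Qed.

Lemma compseq_row_stepE : compseq row_step (iota 0 n) = Tnd D A.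
Proof.
apply/funext => x; apply: functional_extensionality_dep => i.
by rewrite compseq_row_step ltn_ord.
Qed.

Lemma row_step_eq (k : 'I_n) x : row_step k x k = Tnd D A x k.
Proof. by rewrite /row_step eqxx. Qed.

Lemma row_step_neq (k i : 'I_n) x : i != k -> row_step k x i = x i.
Proof. by rewrite /row_step => /negPf; rewrite -val_eqE /= => ->. Qed.

(** A vector killed by [row_step k] is supported at [k], so the coordinate projection identifies the
    two kernels. *)
Lemma alpha_row_step (k : 'I_n) : alpha (row_step k) = alpha (@D k).
Proof.
rewrite !alphaE; apply: (@qdim_iso _ _ _ (fun x : dsum X => x k)).
- by [].
- exact: lsubspace_kernel (linear_row_step k).
- exact: lsubspace1.
- move=> x xk; rewrite /Defs.kernel /=.
  have x0 j : j != k -> x j = 0 by move=> jk; rewrite -(row_step_neq x jk) xk.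
  have : row_step k x k = 0 by rewrite xk.
  rewrite row_step_eq /Tnd big1 ?addr0// => j kj.
  by rewrite x0 ?(linear0P (linA kj))//; rewrite -val_eqE /= gtn_eqF.
- move=> y Dy; pose x : dsum X := dfwith (0 : dsum X) k y.
  have xk : x k = y by rewrite /x dfwithin.
  have x0 j : j != k -> x j = 0 by move=> jk; rewrite /x dfwithout// eq_sym.
  exists x; last by rewrite xk subrr.
  apply: functional_extensionality_dep => i; have [->|ik] := eqVneq i k.
    rewrite row_step_eq /Tnd xk Dy add0r big1// => j kj.
    by rewrite x0 ?(linear0P (linA kj))//; rewrite -val_eqE /= gtn_eqF.
  by rewrite row_step_neq// x0.
- move=> x xk; split=> [->//|/= xk0].
  apply: functional_extensionality_dep => i; have [->//|ik] := eqVneq i k.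
  by rewrite -(row_step_neq x ik) xk.
Qed.

(** A preimage of [x] must agree with [x] off [k], so [x] is in the range exactly when
    $x_k-\sum_{j>k}A_{kj}x_j$ is in the range of $D_k$. This expression, [h], induces the
    isomorphism of cokernels. *)
Lemma beta_row_step (k : 'I_n) : beta (row_step k) = beta (@D k).
Proof.
pose h (x : dsum X) := x k - \sum_(j < n | (k < j)%N) A k (x j).
have lh : linear h.
  move=> a x y; rewrite /h; under eq_bigr => j kj do rewrite (linA kj).
  by rewrite big_split /= -scaler_sumr scalerBr opprD addrACA.
rewrite !betaE; apply: (qdim_iso lh) => //.
- exact: lsubspace_range.
- move=> y _; pose x : dsum X := dfwith (0 : dsum X) k y; exists x => //.
  have xk : x k = y by rewrite /x dfwithin.
  have x0 j : j != k -> x j = 0 by move=> jk; rewrite /x dfwithout// eq_sym.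
  exists 0; rewrite (linear0P (linD (k:=k))) /h xk big1 ?subr0 ?subrr// => j kj.
  by rewrite x0 ?(linear0P (linA kj))//; rewrite -val_eqE /= gtn_eqF.
- move=> x _; split=> [[z <-]|[y Dy]].
    exists (z k); rewrite /h row_step_eq /Tnd.
    rewrite [X in _ - X](eq_bigr (fun j => A k (z j))) ?addrK// => j kj.
    by rewrite row_step_neq// -val_eqE /= gtn_eqF.
  (* The preimage of [x] is [x] itself with its [k]-th coordinate replaced by [y]. *)
  pose z : dsum X := dfwith x k y.
  have zk : z k = y by rewrite /z dfwithin.
  have z0 j : j != k -> z j = x j by move=> jk; rewrite /z dfwithout// eq_sym.
  exists z; apply: functional_extensionality_dep => i; have [->|ik] := eqVneq i k.
    rewrite row_step_eq /Tnd zk Dy /h.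
    rewrite [X in _ + X](eq_bigr (fun j => A k (x j))) ?subrK// => j kj.
    by rewrite z0// -val_eqE /= gtn_eqF.
  by rewrite row_step_neq// z0.
Qed.

End Factorisation.

(** * Right Fredholm and right Weyl operators on Hilbert spaces *)

Section Weyl.
Context {R : realType}.
Implicit Types (H : hilbertSpace R).

(** The spectra use $\lambda-T$ and the sets $\Delta_i$ use $D_k-\lambda$; opposite linear maps
    share kernel and range. *)
Lemma lsubopE H (T : H -> H) l x : lsubop l T x = - opsubl T l x.
Proof. by rewrite /lsubop /opsubl opprB. Qed.

Lemma kernel_lsubop H (T : H -> H) l :
  Defs.kernel (lsubop l T) = Defs.kernel (opsubl T l).
Proof.
by apply/seteqP; split=> x; rewrite /Defs.kernel /= lsubopE => /eqP;
  [rewrite oppr_eq0|rewrite -oppr_eq0] => /eqP.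
Qed.

Lemma linear_opsubl H (T : H -> H) l : linear T -> linear (opsubl T l).
Proof.
move=> lT a x y; rewrite /opsubl lT scalerDr !scalerA (mulrC l) opprD addrACA.
by rewrite -scalerA -scalerBr.
Qed.

Lemma range_lsubop H (T : H -> H) l : linear T ->
  Defs.range (lsubop l T) = Defs.range (opsubl T l).
Proof.
move=> lT; have hN y : opsubl T l (- y) = - opsubl T l y.
  have := linear_opsubl l lT (-1) y 0.
  by rewrite (linear0P (linear_opsubl l lT)) !addr0 !scaleN1r.
apply/seteqP; split=> _ [x <-]; exists (- x); first by rewrite hN -lsubopE.
by rewrite lsubopE hN opprK.
Qed.

Lemma alpha_lsubop H (T : H -> H) l : alpha (lsubop l T) = alpha (opsubl T l).
Proof. by rewrite /alpha kernel_lsubop. Qed.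

Lemma beta_lsubop H (T : H -> H) l : linear T ->
  beta (lsubop l T) = beta (opsubl T l).
Proof. by move=> lT; rewrite /beta range_lsubop. Qed.

(** Continuity of [T] makes the kernel closed, hence complemented by orthogonal projection. *)
Lemma right_fredholm_lsubop H (T : H -> H) l : linear T -> seq_continuous T ->
  right_fredholm (@hinner R H) (lsubop l T) <-> (beta (opsubl T l) < +oo)%E.
Proof.
move=> lT cT; rewrite /right_fredholm beta_lsubop//.
split=> [[]//|bT]; split=> //; rewrite kernel_lsubop.
apply: complemented_closed; first exact/lsubspace_kernel/linear_opsubl.
apply: kernel_closed => u x hu; have := ip_cvgD (cT _ _ hu) (ip_cvgZ (- l) hu).
by rewrite scaleNr; under eq_fun do rewrite scaleNr.
Qed.

Lemma right_weyl_lsubop H (T : H -> H) l : linear T -> seq_continuous T ->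
  right_weyl (@hinner R H) (lsubop l T) <-> weyl (opsubl T l).
Proof.
move=> lT cT; rewrite /right_weyl right_fredholm_lsubop// /weyl /ind.
rewrite alpha_lsubop beta_lsubop//.
have sub (b : (beta (opsubl T l) < +oo)%E) :
    (0 <= alpha (opsubl T l) - beta (opsubl T l))%E =
    (beta (opsubl T l) <= alpha (opsubl T l))%E.
  by rewrite suber_ge0// ge0_fin_numE// beta_ge0.
by split=> -[b]; rewrite sub.
Qed.

End Weyl.

Theorem mainTheorem4 (R : realType) (n : nat) (hn : (2 <= n)%N)
  (X : 'I_n -> hilbertSpace R)
  (hX : forall k : 'I_n, infinite_dimensional (X k))
  (D : forall k : 'I_n, X k -> X k)
  (hD : forall k : 'I_n, bounded_op (@hinner R (X k)) (@hinner R (X k)) (D k))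
  (A : forall i j : 'I_n, X j -> X i)
  (hA : forall i j : 'I_n, (i < j)%N ->
          bounded_op (@hinner R (X j)) (@hinner R (X i)) (A i j)) :
  let a (s : 'I_n) (l : R[i]) : \bar R := alpha (opsubl (D s) l) in
  let b (s : 'I_n) (l : R[i]) : \bar R := beta (opsubl (D s) l) in
  let Delta1 : set R[i] :=
    [set l | exists k : 'I_n, [/\ (k < n.-1)%N,
        b k l = +oo%E,
        (forall s : 'I_n, (k < s)%N -> (s < n.-1)%N -> (b s l < +oo)%E) &
        (\sum_(s < n | (k < s)%N) a s l)%E = +oo%E]
      /\ (forall last : 'I_n, val last = n.-1 -> rho_re (@hinner R (X last)) (D last) l)
      /\ (\sum_(s < n) b s l <= \sum_(s < n) a s l)%E] in
  let Delta2 : set R[i] :=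
    [set l | exists k : 'I_n, [/\ (forall s : 'I_n, (b s l < +oo)%E),
        (\sum_(s < n) b s l <= \sum_(s < n) a s l)%E &
        (a k l < b k l)%E]] in
  [set l | exists k : 'I_n, sigma_rw (@hinner R (X k)) (D k) l] =
    sigma_rw (@ds_inner R n X) (Tnd D A) `|` Delta1 `|` Delta2.
Proof.
move=> a b Delta1 Delta2.
have lD k : linear (@D k) by move: (hD k) => [].
have lA (i j : 'I_n) : (i < j)%N -> linear (@A i j) by move=> /hA[].
have lT := linear_Tnd lD lA.
have cT := Tnd_seq_continuous hD hA.
have cD k : seq_continuous (@D k) by move=> u x; exact: bounded_op_cvg.
have n0 : (0 < n)%N by exact: ltnW.
apply/seteqP.
suff main l : (exists k : 'I_n, sigma_rw (@hinner R (X k)) (@D k) l) <->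
    (sigma_rw (@ds_inner R n X) (Tnd D A) `|` Delta1 `|` Delta2) l.
  by split=> l; rewrite /= main.
(* For fixed [l], subtracting [l] changes only the diagonal, so the shifted matrix factors into row
   operations with diagonal entries $D_s-l$. *)
pose D' (s : 'I_n) := opsubl (@D s) l.
have lD' s : linear (@D' s) by exact/linear_opsubl.
pose F := @row_step R n X D' A; have lF k : linear (F k) := linear_row_step lD' lA k.
have aF (s : 'I_n) : alpha (F s) = a s l by exact: alpha_row_step.
have bF (s : 'I_n) : beta (F s) = b s l by exact: beta_row_step.
have TE : opsubl (Tnd D A) l = compseq F (iota 0 n).
  rewrite compseq_row_stepE; apply/funext => x.
  apply: functional_extensionality_dep => i.
  by rewrite /opsubl /Tnd /D' /opsubl addrAC.
have wF (s : 'I_n) : weyl (F s) <-> right_weyl (@hinner R (X s)) (lsubop l (@D s)).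
  by rewrite right_weyl_lsubop// /weyl aF bF.
have wT : weyl (compseq F (iota 0 n)) <->
    right_weyl (@ds_inner R n X) (lsubop l (Tnd D A)).
  (* The inner product of [ds_hilbert X] is [ds_inner], so the Hilbert space criterion applies to
     the matrix. *)
  by rewrite -TE -(@right_weyl_lsubop _ (ds_hilbert X)).
have Sa : (\sum_(0 <= s < n) alpha (F s) = \sum_(s < n) a s l)%E.
  by rewrite big_mkord; apply: eq_bigr => s _.
have Sb : (\sum_(0 <= s < n) beta (F s) = \sum_(s < n) b s l)%E.
  by rewrite big_mkord; apply: eq_bigr => s _.
have St (k : 'I_n) :
    (\sum_(k.+1 <= s < n) alpha (F s) = \sum_(s < n | (k < s)%N) a s l)%E.
  rewrite (big_nat_widenl _ 0)// big_mkord; apply: eq_big => s //.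
(* Quantifying over all indices of value [n.-1] amounts to evaluating at the single one. *)
have lastP (P : 'I_n -> Prop) (i : 'I_n) : val i = n.-1 ->
    (forall j : 'I_n, val j = n.-1 -> P j) <-> P i.
  move=> iE; split=> [|Pi j jE]; first exact.
  by rewrite (_ : j = i)//; apply: val_inj; rewrite iE jE.
have n1 : (n.-1 < n)%N by rewrite prednK.
pose last := Ordinal n1.
have rho : (forall j : 'I_n, val j = n.-1 -> rho_re (@hinner R (X j)) (@D j) l) <->
    (beta (F n.-1) < +oo)%E.
  rewrite (lastP _ last erefl) /rho_re /sigma_re /setC /=.
  rewrite (bF last) -right_fredholm_lsubop//; split=> [/contrapT//|h]; exact.
(* What remains is to match natural-number indices below [n] with ordinals. *)
have := weyl_compseq lF n0; rewrite Sa Sb => core.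
split.
- move=> [k hk]; have /core : exists2 k, (k < n)%N & ~ weyl (F k).
    by exists k => //; rewrite wF.
  case=> [nT|[m [[mn bm bs tl] bl Sab]]|[m [mn bs Sab ab]]].
  + by left; left=> /wT.
  + left; right; have mn' := leq_trans mn (leq_pred n).
    exists (Ordinal mn'); split; last by split=> //; exact/rho.
    split=> //; first by rewrite -bF.
      by move=> s ms sn; rewrite -bF; exact: bs.
    by rewrite -St.
  + right; exists (Ordinal mn); split=> //; last by rewrite -aF -bF.
    by move=> s; rewrite -bF; exact: bs.
- move=> h; suff /core[k kn nw] : [\/ ~ weyl (compseq F (iota 0 n)),
     exists k, [/\ [/\ (k < n.-1)%N, beta (F k) = +oo%E,
        forall s, (k < s)%N -> (s < n.-1)%N -> (beta (F s) < +oo)%E &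
        (\sum_(k.+1 <= s < n) alpha (F s))%E = +oo%E], (beta (F n.-1) < +oo)%E &
        (\sum_(s < n) b s l <= \sum_(s < n) a s l)%E] |
     exists k, [/\ (k < n)%N, forall s, (s < n)%N -> (beta (F s) < +oo)%E,
        (\sum_(s < n) b s l <= \sum_(s < n) a s l)%E &
        (alpha (F k) < beta (F k))%E] ].
    by exists (Ordinal kn) => hk; apply: nw; exact: (wF (Ordinal kn)).2.
  case: h => [[nT|[k [[kn bk bs tl] [/rho bl Sab]]]]|[k [bs Sab ab]]].
  + by constructor 1 => /wT.
  + constructor 2; exists k; split=> //; split=> //; first by rewrite bF.
      move=> s ks sn; have sn' := leq_trans sn (leq_pred n).
      by rewrite (bF (Ordinal sn')); exact: bs.
    by rewrite St.
  + constructor 3; exists k; split=> //; last by rewrite aF bF.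
    by move=> s sn; rewrite (bF (Ordinal sn)).
Qed.
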